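(* Let $V$ be a vertex operator algebra, $p$ a positive integer, $\omega_p$ a primitive $p$-th root of unity, and $\nu$ an automorphism of $V$ with $\nu^p=1_V$. Let $M$ be a vector space (not assumed graded) equipped with a linear map $Y_M(\cdot,x):V\to(\mathrm{End}\,M)[[x^{1/p},x^{-1/p}]]$ satisfying the truncation condition and the $\nu$-twisted Jacobi identity. Then for all $u,v\in V$ and $s\in\mathbb Z$, $$\lim_{x_1^{1/p}\to\omega_p^s(x_2+x_0)^{1/p}}\Big((x_1-x_2)^{k(u,v)}\,Y_M(u,x_1)\,Y_M(v,x_2)\Big)=x_0^{k(u,v)}\,Y_M(Y(\nu^{-s}u,x_0)v,x_2).$$
   Context: Vector spaces are over $\mathbb C$; $x,x_0,x_1,x_2$ are commuting formal variables; $\delta(x)=\sum_{n\in\mathbb Z}x^n$. The symbol $x^{1/p}$ is a formal variable whose $p$-th power is $x$. Binomial expansion convention: a (possibly fractional) power of a binomial is expanded in nonnegative integral powers of the second variable. A vertex operator algebra $(V,Y,\mathbf 1,\omega)$ is a $\mathbb Z$-graded space $V=\coprod_n V_{(n)}$ with $V_{(n)}=0$ for $n$ sufficiently negative and $\dim V_{(n)}<\infty$, with a linear map $v\mapsto Y(v,x)=\sum_{n\in\mathbb Z}v_nx^{-n-1}\in(\mathrm{End}\,V)[[x,x^{-1}]]$ and vectors $\mathbf 1,\omega\in V$ such that: for $v,w\in V$, $v_nw=0$ for $n$ large; $Y(\mathbf 1,x)=1_V$; $Y(v,x)\mathbf 1\in V[[x]]$ with constant term $v$; writing $Y(\omega,x)=\sum_n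 L(n)x^{-n-2}$, $[L(m),L(n)]=(m-n)L(m+n)+c_V\frac{m^3-m}{12}\delta_{m+n,0}1_V$ for some $c_V\in\mathbb C$, $L(0)v=nv$ for $v\in V_{(n)}$, $Y(L(-1)u,x)=\frac{d}{dx}Y(u,x)$; and the Jacobi identity $x_0^{-1}\delta\big(\frac{x_1-x_2}{x_0}\big)Y(u,x_1)Y(v,x_2)-x_0^{-1}\delta\big(\frac{x_2-x_1}{-x_0}\big)Y(v,x_2)Y(u,x_1)=x_2^{-1}\delta\big(\frac{x_1-x_0}{x_2}\big)Y(Y(u,x_0)v,x_2)$. An automorphism $\nu$ of $V$ is a linear automorphism fixing $\omega$ and $\mathbf 1$ with $\nu Y(v,x)\nu^{-1}=Y(\nu v,x)$ for $v\in V$. Write $Y_M(v,x)=\sum_{n\in\frac1p\mathbb Z}v_n^\nu x^{-n-1}$. Truncation condition: for $v\in V$, $w\in M$, $v_n^\nu w=0$ for $n\in\frac1p\mathbb Z$ sufficiently large. $\nu$-twisted Jacobi identity: for $u,v\in V$, $x_0^{-1}\delta\big(\frac{x_1-x_2}{x_0}\big)Y_M(u,x_1)Y_M(v,x_2)-x_0^{-1}\delta\big(\frac{x_2-x_1}{-x_0}\big)Y_M(v,x_2)Y_M(u,x_1)=\frac1px_2^{-1}\sum_{r=0}^{p-1}\delta\Big(\omega_p^r\big(\frac{x_1-x_0}{x_2}\big)^{1/p}\Big)Y_M(Y(\nu^ru,x_0)v,x_2)$. For $u,v\in V$, $k(u,v)$ is the smallest nonnegative integer $k$ such that $(x_1-x_2)^kY_M(u,x_1)Y_M(v,x_2)=(x_1-x_2)^kY_M(v,x_2)Y_M(u,x_1)$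 (such $k$ exists). The formal limit $\lim_{x_1^{1/p}\to\omega_p^s(x_2+x_0)^{1/p}}f$ means: replace each integral power of the formal variable $x_1^{1/p}$ in the (fully multiplied out) formal series $f$ by the corresponding power of $\omega_p^s(x_2+x_0)^{1/p}$, expanded in nonnegative powers of $x_0$ (operators being applied to an arbitrary fixed vector of $M$); that this is well defined is part of the assertion. *)

(* Defs.v *)
From mathcomp Require Import all_boot all_order all_algebra.
From mathcomp Require Import all_classical all_reals.
From mathcomp Require Export complex.

Set Implicit Arguments.
Unset Strict Implicit.
Unset Printing Implicit Defensive.

Import Order.TTheory GRing.Theory Num.Theory.

Local Open Scope classical_set_scope.
Local Open Scope ring_scope.

(* The exponent (a, b, c) stands for the monomial
   x0^a x1^(b/p) x2^(c/p); the integer p is fixed by the context (p = 1 for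
   untwisted vertex operators). A formal series with coefficients in A is an
   arbitrary function from exponents to A. *)
Notation expo := (int * int * int)%type.

Definition x0 : expo := (1, 0, 0).
Definition x1root : expo := (0, 1, 0).
Definition x2root : expo := (0, 0, 1).
Definition x1 (p : nat) : expo := x1root *+ p.
Definition x2 (p : nat) : expo := x2root *+ p.

Definition series (A : Type) : Type := expo -> A.

Section FormalSeries.
Variable F : numFieldType.

Definition gbinom (a : F) (k : nat) : F :=
  (\prod_(i < k) (a - i%:R)) / k`!%:R.

(* (x + c y)^(n/p) = sum_(k >= 0) gbinom (n/p) k c^k x^(n/p - k) y^k, where
   xr is the exponent of x^(1/p) and y is the exponent of y. *)
Definition binpow (p : nat) (n : int) (xr y : expo) (c : F) : series F :=
  fun e => \sum_(k \in [set k : nat | e = xr *~ (n - (p * k)%:Z) + y *+ k])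
    gbinom (n%:~R / p%:R) k * c ^+ k.

(* Multiplication by the monomial of exponent a. *)
Definition xmul (A : Type) (a : expo) (f : series A) : series A :=
  fun e => f (e - a).

(* sum_(n in Z) c^n z^(-n) (x - y)^(n q/p), where z is the exponent of the
   denominator: this is delta((x - y)/(c^-1 z)) for q = p, and
   delta(c ((x - y)/z^p)^(1/p)) for q = 1. *)
Definition fdelta (p q : nat) (c : F) (xr y z : expo) : series F :=
  fun e => \sum_(n \in [set: int])
    c ^ n * binpow p (n * q%:Z) xr y (-1) (e + z *~ n).

Variable M : lmodType F.

(* The sum over a is finite for all the products formed below, as soon as the
   truncation condition holds. *)
Definition fmul (f : series F) (g : series M) : series M :=
  fun e => \sum_(a \in [set: expo]) f a *: g (e - a).

(* Contribution, to the coefficient of exponent e, of the term t of f once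
   (x1^(1/p))^n is replaced by w^(s n) (x2 + x0)^(n/p). *)
Definition lim_term (p : nat) (w : F) (s : int) (f : series M) (e t : expo) : M :=
  let: (a, b, c) := t in
  (w ^ (s * b) * xmul (a, 0, c) (binpow p b x2root x0 1) e) *: f t.

(* The limit of f as x1^(1/p) tends to w^s (x2 + x0)^(1/p) is well defined
   and equal to g. *)
Definition is_formal_lim (p : nat) (w : F) (s : int) (f g : series M) : Prop :=
  forall e, finite_set [set t | lim_term p w s f e t != 0] /\
            \sum_(t \in [set: expo]) lim_term p w s f e t = g e.

End FormalSeries.

Section VertexOperators.
Variables (F : numFieldType) (V M : lmodType F).

(* Y v n is the coefficient of (x^(1/p))^n in Y(v, x). *)
Definition vertex_map : Type := V -> int -> {linear M -> M}.

Definition vmap_linear (Y : vertex_map) : Prop :=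
  forall n w, linear (fun v => Y v n w).

(* mode p Y v m is v_(m/p), the coefficient of x^(-m/p-1). *)
Definition mode (p : nat) (Y : vertex_map) (v : V) (m : int) : {linear M -> M} :=
  Y v (- m - p%:Z).

Definition truncation (p : nat) (Y : vertex_map) : Prop :=
  forall v w, exists N : int, forall m, N <= m -> mode p Y v m w = 0.

(* Y(u,x1) Y(v,x2) w *)
Definition Y1Y2 (Y : vertex_map) (u v : V) (w : M) : series M :=
  fun '(a, b, c) => if a == 0 then Y u b (Y v c w) else 0.

(* Y(v,x2) Y(u,x1) w *)
Definition Y2Y1 (Y : vertex_map) (u v : V) (w : M) : series M :=
  fun '(a, b, c) => if a == 0 then Y v c (Y u b w) else 0.

(* Left-hand side of the Jacobi identity, applied to w. *)
Definition jacobi_lhs (p : nat) (Y : vertex_map) (u v : V) (w : M) : series M :=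
  fun e =>
    fmul (xmul (- x0) (fdelta p p 1 x1root (x2 p) x0)) (Y1Y2 Y u v w) e
    - fmul (xmul (- x0) (fdelta p p (-1) x2root (x1 p) x0)) (Y2Y1 Y u v w) e.

Definition weak_comm (p : nat) (Y : vertex_map) (u v : V) (k : nat) : Prop :=
  forall w, fmul (binpow p (p * k)%:Z x1root (x2 p) (-1)) (Y1Y2 Y u v w)
          = fmul (binpow p (p * k)%:Z x1root (x2 p) (-1)) (Y2Y1 Y u v w).

(* k(u,v); the value is 0 if no such k exists. *)
Definition comm_order (p : nat) (Y : vertex_map) (u v : V) : nat :=
  xget 0%N [set k | weak_comm p Y u v k /\
                    forall j, weak_comm p Y u v j -> (k <= j)%N].

End VertexOperators.

(* YM(Y(u,x0)v,x2) w *)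
Definition Yiter (F : numFieldType) (V M : lmodType F) (Y : vertex_map V V)
    (YM : vertex_map V M) (u v : V) (w : M) : series M :=
  fun '(a, b, c) => if b == 0 then YM (Y u a v) c w else 0.

Record voa (F : numFieldType) (V : lmodType F) := Voa {
  homog : int -> set V;
  vY : vertex_map V V;
  vac : V;
  conf : V;
  central : F;
  L := fun n : int => vY conf (- n - 2);
  (* each V_(n) is a finite-dimensional subspace *)
  homog_findim : forall n, exists (d : nat) (b : 'I_d -> V),
    homog n = [set \sum_(i < d) c i *: b i | c in [set: 'I_d -> F]];
  homog_lower : exists N : int, forall n, n < N -> homog n = [set 0];
  homog_dirsum : forall v, exists! f : int -> V,
    [/\ forall n, homog n (f n), finite_set [set n | f n != 0]
      & v = \sum_(n \in [set: int]) f n];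
  vY_linear : vmap_linear vY;
  vY_trunc : truncation 1 vY;
  vY_vac : forall n v, vY vac n v = if n == 0 then v else 0;
  vY_creation : forall v n, n < 0 -> vY v n vac = 0;
  vY_creation0 : forall v, vY v 0 vac = v;
  virasoro : forall (m n : int) v,
    L m (L n v) - L n (L m v)
    = (m - n)%:~R *: L (m + n) v
      + (if m + n == 0 then central * ((m ^+ 3 - m)%:~R / 12%:R) else 0) *: v;
  L0_grading : forall n v, homog n v -> L 0 v = n%:~R *: v;
  L1_derivative : forall u n v, vY (L (-1) u) n v = (n + 1)%:~R *: vY u (n + 1) v;
  vY_jacobi : forall u v w,
    jacobi_lhs 1 vY u v w
    = fmul (xmul (- x2 1) (fdelta 1 1 1 x1root x0 (x2 1))) (Yiter vY vY u v w)
}.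

Record voa_aut (F : numFieldType) (V : lmodType F) (A : voa V) := VoaAut {
  aut :> {linear V -> V};
  aut_inv : V -> V;
  autK : cancel aut aut_inv;
  aut_invK : cancel aut_inv aut;
  aut_vac : aut (vac A) = vac A;
  aut_conf : aut (conf A) = conf A;
  aut_vY : forall v n w, aut (vY A v n (aut_inv w)) = vY A (aut v) n w
}.

Definition aut_pow (F : numFieldType) (V : lmodType F) (A : voa V)
    (nu : voa_aut A) (s : int) : V -> V :=
  match s with
  | Posz n => iter n nu
  | Negz n => iter n.+1 (aut_inv nu)
  end.

Definition twisted_jacobi (F : numFieldType) (V M : lmodType F) (A : voa V)
    (nu : voa_aut A) (p : nat) (wp : F) (YM : vertex_map V M) : Prop :=
  forall u v w,
    jacobi_lhs p YM u v w
    = fun e => p%:R^-1 *: \sum_(0 <= r < p)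
        fmul (xmul (- x2 p) (fdelta p 1 (wp ^+ r) x1root x0 x2root))
             (Yiter (vY A) YM (aut_pow nu r%:Z u) v w) e.

(* Main.v *)
Require Import Defs.
From mathcomp Require Import all_boot all_order all_algebra.
From mathcomp Require Import all_classical all_reals.
From mathcomp Require Import zify ring.

(** Write A(x1,x2) = Y_M(u,x1) Y_M(v,x2) w, B(x1,x2) = Y_M(v,x2) Y_M(u,x1) w,
    H_r(x0,x2) = Y_M(Y(nu^r u,x0)v,x2) w and F = (x1-x2)^k A for a fixed w in M.

    The coefficient of x0^(-k-1) in the twisted Jacobi identity, for k so large
    that no H_r has a power of x0 below -k, is (x1-x2)^k A = (x1-x2)^k B
    ([cleared_comm]). This k does not depend on w, so k(u,v) exists, and for
    k = k(u,v) the exponents of x1 and of x2 in F are both bounded below: those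
    of x2 by the truncation of A, those of x1 by that of B. Hence the formal
    limit is coefficientwise a finite sum ([formal_lim]).

    To compute it, multiply the Jacobi identity by x0^k and take the coefficient
    of x1^(-1-n/p). When n is large the term in B does not contribute, and the
    identity reads
      sum_(b = -n mod p) (x2+x0)^((b+n)/p) F_b(x2)
        = (1/p) (x2+x0)^(n/p) sum_r w_p^(-rn) x0^k H_r(x0,x2),
    where F_b(x2) is the coefficient of x1^(b/p) in F: in terms of coefficients
    the binomials of the left-hand side arise by upper negation. Multiplication
    by (x2+x0)^(-n/p) turns this into
      sum_(b = -n mod p) (x2+x0)^(b/p) F_b(x2)
        = (1/p) sum_r w_p^(-rn) x0^k H_r(x0,x2)
    ([cleared_component]). It remains to sum this over n mod p with the weights
    w_p^(-sn) = w_p^(sb): the left-hand side becomes the limit, and by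
    orthogonality of the powers of w_p only the term r = -s mod p survives on
    the right ([cleared_limit]).

    All products of formal series are evaluated as sums over one natural number
    weighted by binomial coefficients ([bsum]), and the main fact about these sums
    is the Chu-Vandermonde identity, which composes them ([bsum_bsum]). *)

Set Implicit Arguments.
Unset Strict Implicit.

Import GRing.Theory Num.Theory.
Local Open Scope ring_scope.

(** * Generalized binomial coefficients *)

Section Binomials.
Variable F : numFieldType.
Implicit Types (a b : F) (k n : nat).

Lemma gbinom_0r a : gbinom a 0 = 1.
Proof. by rewrite /gbinom big_ord0 fact0 divr1. Qed.

Lemma gbinomS a k : k.+1%:R * gbinom a k.+1 = (a - k%:R) * gbinom a k.
Proof.
have k1 : k.+1%:R != 0 :> F by rewrite pnatr_eq0.
rewrite /gbinom big_ord_recr /= factS natrM invfM.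
by rewrite [LHS]mulrCA (mulVKf k1) -mulrA mulrCA.
Qed.

Lemma gbinom_nat n k : gbinom n%:R k = 'C(n, k)%:R :> F.
Proof.
elim: k => [|k IH]; first by rewrite gbinom_0r bin0.
have k1 : k.+1%:R != 0 :> F by rewrite pnatr_eq0.
apply: (mulfI k1); rewrite gbinomS IH -natrM.
have [lekn|ltnk] := leqP k n; first by rewrite -natrB // -natrM mul_bin_left.
by rewrite !bin_small ?mulr0 ?muln0 // ltnS ltnW.
Qed.

Lemma gbinom_neg a k : gbinom (- a - 1) k * (-1) ^+ k = gbinom (a + k%:R) k.
Proof.
rewrite /gbinom mulrAC; congr (_ / _).
rewrite -[in (-1) ^+ k](card_ord k) -prodr_const -big_split /=.
rewrite (reindex_inj rev_ord_inj) /=; apply: eq_bigr => i _.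
by rewrite natrB //; ring.
Qed.

Lemma gbinom_vandermonde a b n :
  \sum_(i < n.+1) gbinom a i * gbinom b (n - i) = gbinom (a + b) n.
Proof.
elim: n => [|n IH].
  by rewrite big_ord_recr big_ord0 /= !gbinom_0r add0r mulr1.
have n1 : n.+1%:R != 0 :> F by rewrite pnatr_eq0.
apply: (mulfI n1); rewrite gbinomS -IH !mulr_sumr.
(* Weight each term by n + 1 = i + (n + 1 - i) and lower the matching index. *)
pose g i := (a - i%:R) * gbinom a i * gbinom b (n - i).
pose h i := gbinom a i * ((b - (n - i)%:R) * gbinom b (n - i)).
transitivity (\sum_(i < n.+1) g i + \sum_(i < n.+1) h i).
  rewrite (eq_bigr (fun i : 'I_n.+2 =>
    i%:R * gbinom a i * gbinom b (n.+1 - i) +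
    gbinom a i * ((n.+1 - i)%:R * gbinom b (n.+1 - i)))); last first.
    move=> i _; rewrite -[in n.+1%:R](subnKC (ltnSE (ltn_ord i))) natrD; ring.
  rewrite big_split /=; congr (_ + _).
    rewrite big_ord_recl /= !mul0r add0r; apply: eq_bigr => i _.
    by rewrite /bump /= add1n subSS gbinomS.
  rewrite big_ord_recr /= subnn mul0r mulr0 addr0; apply: eq_bigr => i _.
  by rewrite subSn ?gbinomS // -ltnS ltn_ord.
rewrite -big_split; apply: eq_bigr => i _; rewrite /g /h /=.
by rewrite (natrB _ (ltnSE (ltn_ord i))); ring.
Qed.

End Binomials.

(** * Sums weighted by binomial coefficients *)

Section BinomialSums.
Variables (F : numFieldType) (M : lmodType F).
Implicit Types (a b e : F) (f g : nat -> M).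

Lemma natsum_trunc g N : (forall i, (N <= i)%N -> g i = 0) ->
  \sum_(i \in [set: nat]) g i = \sum_(i < N) g i.
Proof.
move=> gN; rewrite fsbig_ord; apply/esym/fsbig_widen => // i [_ /= /negP].
by rewrite -leqNgt => /gN.
Qed.

(** [bsum a e g] is the sum over i >= 0 of the i-th coefficient of (1 + e y)^a
    times [g i]; like every sum over a set, it is 0 when infinitely many terms
    are nonzero. *)
Definition bsum a e g : M := \sum_(i \in [set: nat]) (gbinom a i * e ^+ i) *: g i.

Lemma eq_bsum a e f g : f =1 g -> bsum a e f = bsum a e g.
Proof. by move=> fg; apply: eq_fsbigr => i _; rewrite fg. Qed.

Lemma bsum_trunc a e g N : (forall i, (N <= i)%N -> g i = 0) ->
  bsum a e g = \sum_(i < N) (gbinom a i * e ^+ i) *: g i.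
Proof. by move=> gN; apply: natsum_trunc => i /gN ->; rewrite scaler0. Qed.

Lemma bsum_0 a e g : (forall i, g i = 0) -> bsum a e g = 0.
Proof. by move=> g0; rewrite (@bsum_trunc _ _ _ 0) ?big_ord0. Qed.

Lemma bsum_nat n e g :
  bsum n%:R e g = \sum_(i < n.+1) ('C(n, i)%:R * e ^+ i) *: g i.
Proof.
rewrite /bsum (@natsum_trunc _ n.+1) => [|i ni].
  by apply: eq_bigr => i _; rewrite gbinom_nat.
by rewrite gbinom_nat bin_small // mul0r scale0r.
Qed.

Lemma bsum_eq0l e g : bsum 0 e g = g 0%N.
Proof. by rewrite -[0]/(0%:R) bsum_nat big_ord1 bin0 mul1r scale1r. Qed.

(** The identity (1 + e y)^a (1 + e y)^b = (1 + e y)^(a + b), read on the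
    coefficients of a product. *)
Lemma bsum_bsum a b e g N : (forall i, (N <= i)%N -> g i = 0) ->
  bsum a e (fun i => bsum b e (fun j => g (i + j)%N)) = bsum (a + b) e g.
Proof.
move=> gN.
have gN2 i j : (N <= i)%N -> g (i + j)%N = 0.
  by move=> Ni; apply: gN; rewrite (leq_trans Ni) ?leq_addr.
rewrite (bsum_trunc _ _ gN) (@bsum_trunc _ _ _ N) => [|i Ni]; last first.
  by apply: bsum_0 => j; apply: gN2.
under [RHS]eq_bigr => l _ do rewrite -gbinom_vandermonde mulr_suml scaler_suml.
pose t i l := (gbinom a i * gbinom b (l - i) * e ^+ l) *: g l.
transitivity (\sum_(i < N) \sum_(0 <= l < N | (i <= l)%N) t i l); last first.
  under [LHS]eq_bigr => i _ do rewrite big_mkord.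
  rewrite (exchange_big_dep predT) //=; apply: eq_bigr => l _.
  rewrite -(big_mkord (fun i => (i <= l)%N) (fun i => t i l)).
  rewrite -(big_mkord predT (fun i => t i l)).
  by rewrite (big_nat_widen 0 l.+1 N).
apply: eq_bigr => i _.
rewrite -(big_nat_widenl i 0 N predT) // -{1}[nat_of_ord i]add0n.
rewrite (big_addn 0) big_mkord (@bsum_trunc _ _ _ (N - i)); last first.
  by move=> j; rewrite leq_subLR => /gN.
rewrite scaler_sumr; apply: eq_bigr => j _.
rewrite scalerA /t addnK [(j + i)%N]addnC exprD; congr (_ *: _); ring.
Qed.

(** The bound [N] keeps all the sums finite, hence additive. *)
Lemma bsum_scale_sum a e N (n : nat) (x : F) (y : nat -> F) (g : nat -> nat -> M) :
  (forall r i, (r < n)%N -> (N <= i)%N -> g r i = 0) ->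
  bsum a e (fun i => x *: \sum_(0 <= r < n) y r *: g r i)
  = x *: \sum_(0 <= r < n) y r *: bsum a e (g r).
Proof.
move=> gN; rewrite (@bsum_trunc _ _ _ N) => [|i Ni]; last first.
  by rewrite big_nat big1 ?scaler0 // => r /andP[_ rn]; rewrite gN ?scaler0.
transitivity (\sum_(i < N) \sum_(0 <= r < n)
    (x * y r) *: ((gbinom a i * e ^+ i) *: g r i)).
  apply: eq_bigr => i _; rewrite scalerA scaler_sumr; apply: eq_bigr => r _.
  by rewrite !scalerA; congr (_ *: _); ring.
rewrite exchange_big /= scaler_sumr; apply: eq_big_nat => r /andP[_ rn].
by rewrite (@bsum_trunc _ _ _ N) ?scalerA ?scaler_sumr // => i; apply: gN.
Qed.

Lemma bsum_rev k g :
  bsum k%:R (-1) (fun i => g (k - i)%N) = (-1) ^+ k *: bsum k%:R (-1) g.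
Proof.
rewrite !bsum_nat (reindex_inj rev_ord_inj) scaler_sumr /=.
apply: eq_bigr => i _; have ik := ltnSE (ltn_ord i).
rewrite scalerA subSS subKn // bin_sub // mulrCA; congr (_ * _ *: _).
have -> : (-1) ^+ k = (-1) ^+ (k - i) * (-1) ^+ i :> F by rewrite -exprD subnK.
by rewrite -mulrA -expr2 sqrr_sign mulr1.
Qed.

(** After upper negation the coefficient of [f (n + i)] is
    'C(n + i, i) = 'C(n + i, n), which vanishes for the added indices m < n. *)
Lemma bsum_upper_neg n f N : (forall m, (N <= m)%N -> f m = 0) ->
  bsum (- n%:R - 1) (-1) (fun i => f (n + i)%N)
  = \sum_(m < N) 'C(m, n)%:R *: f m.
Proof.
move=> fN; rewrite (@bsum_trunc _ _ _ (N - n)) => [|i]; last first.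
  by rewrite leq_subLR => /fN.
under eq_bigr => i _.
  rewrite gbinom_neg -natrD gbinom_nat -(bin_sub (leq_addl n i)) addnK.
  over.
rewrite -(big_mkord predT (fun i => 'C(n + i, n)%:R *: f (n + i)%N)).
rewrite -(big_mkord predT (fun m => 'C(m, n)%:R *: f m)) /=.
have [Nn|nN] := leqP N n.
  rewrite (eqP Nn) big_geq // big_nat big1 // => m /andP[_ mN].
  by rewrite bin_small ?scale0r // (leq_trans mN).
rewrite [RHS](big_cat_nat (leq0n n) (ltnW nN)) /= [X in X + _]big_nat.
rewrite [X in X + _]big1 ?add0r => [|m /andP[_ mn]]; last first.
  by rewrite bin_small ?scale0r.
rewrite (big_addn 0 N n); apply: eq_bigr => i _.
by rewrite addnC.
Qed.

Lemma intsum_trunc (f : int -> M) (l : int) (N : nat) :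
  (forall b : int, b < l -> f b = 0) ->
  (forall b : int, l + N%:Z <= b -> f b = 0) ->
  \sum_(b \in [set: int]) f b = \sum_(0 <= q < N) f (l + q%:Z).
Proof.
move=> fl fr; rewrite (fsbigE [seq l + q%:Z | q <- index_iota 0 N]) //.
- by rewrite big_map; apply: eq_bigl => q; rewrite in_setT.
- by rewrite map_inj_uniq ?iota_uniq // => i j /addrI [].
move=> b _ /negP bN; have [/fl //|lb] := ltrP b l.
have [/fr //|bl] := lerP (l + N%:Z) b; case: bN; apply/mapP.
exists `|b - l|%N; last by lia.
by rewrite mem_index_iota; lia.
Qed.

End BinomialSums.

Lemma sum_unity_root (F : fieldType) (z : F) (n : nat) :
  z ^+ n = 1 -> z != 1 -> \sum_(i < n) z ^+ i = 0.
Proof.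
move=> zn z1; apply: (mulfI (x := z - 1)); first by rewrite subr_eq0.
by rewrite -subrX1 zn subrr mulr0.
Qed.

(** * The Jacobi identity on coefficients *)

Section JacobiCoefficients.
Variables (F : numFieldType) (M : lmodType F) (p : nat) (w : F).
Hypothesis p_gt0 : (0 < p)%N.
(* [A b c] and [B b c] are the coefficients of x1^(b/p) x2^(c/p) in
   Y_M(u,x1) Y_M(v,x2) w and Y_M(v,x2) Y_M(u,x1) w, and [H r a c] is that of
   x0^a x2^(c/p) in Y_M(Y(nu^r u,x0)v,x2) w. *)
Variables (A B : int -> int -> M) (H : nat -> int -> int -> M).
Variables (C0 B0 A0 : int).
Hypothesis A_trunc : forall b c : int, c <= C0 -> A b c = 0.
Hypothesis B_trunc : forall b c : int, b <= B0 -> B b c = 0.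
Hypothesis H_trunc : forall r (a c : int), (r < p)%N -> a <= A0 -> H r a c = 0.

(** The coefficient of x1^(b/p) x2^(c/p) in (x1 - x2)^k X(x1,x2). *)
Definition cleared (X : int -> int -> M) k (b c : int) : M :=
  bsum k%:R (-1) (fun i => X (b - (p * k)%:Z + (p * i)%:Z) (c - (p * i)%:Z)).

(* The coefficient of x0^a x1^(b/p) x2^(c/p) in the twisted Jacobi identity;
   on the right, (x1 - x0)^(n/p) has been rewritten with n = b + pj by upper
   negation. *)
Hypothesis jacobi : forall a b c : int,
  bsum (- a%:~R - 1) (-1)
    (fun i => A (b + p%:Z * (a + 1) + (p * i)%:Z) (c - (p * i)%:Z))
  - (-1) ^ (- a - 1) *: bsum (- a%:~R - 1) (-1)
    (fun i => B (b - (p * i)%:Z) (c + p%:Z * (a + 1) + (p * i)%:Z))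
  = p%:R^-1 *: \sum_(0 <= r < p) (w ^+ r) ^ b *:
      bsum (- (b%:~R / p%:R) - 1) 1
        (fun j => H r (a - j%:Z) (c + p%:Z + b + (p * j)%:Z)).

(** For a = -k-1 the delta functions on the left have the coefficients of
    (x1 - x2)^k, and the right-hand side vanishes because -k-1 <= A0. *)
Lemma cleared_comm b c : cleared A `|A0|%N b c = cleared B `|A0|%N b c.
Proof.
set k := `|A0|%N.
have := jacobi (- k%:Z - 1) b c.
rewrite [X in _ = _ *: X -> _]big_nat [X in _ = _ *: X -> _]big1; last first.
  move=> r /andP[_ rp].
  by rewrite bsum_0 ?scaler0 // => j; apply: H_trunc => //; lia.
have -> : - (- k%:Z - 1)%:~R - 1 = k%:R :> F by ring.
have -> : - (- k%:Z - 1) - 1 = k%:Z by ring.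
rewrite scaler0 => /subr0_eq eqAB.
transitivity (bsum k%:R (-1) (fun i : nat =>
    A (b + p%:Z * (- k%:Z - 1 + 1) + (p * i)%:Z) (c - (p * i)%:Z))).
  by apply: eq_bsum => i; congr (A _ _); lia.
transitivity ((-1) ^+ k *: ((-1) ^+ k *: cleared B k b c)); last first.
  by rewrite scalerA -expr2 sqrr_sign scale1r.
rewrite eqAB; congr (_ *: _); rewrite -bsum_rev !bsum_nat; apply: eq_bigr => i _.
by congr (_ *: B _ _); have := ltnSE (ltn_ord i); nia.
Qed.

Section Cleared.
Variable k : nat.
Hypothesis AB_comm : forall b c, cleared A k b c = cleared B k b c.

Lemma cleared_trunc_r (b c : int) : c <= C0 -> cleared A k b c = 0.
Proof. by move=> cC; apply: bsum_0 => i; apply: A_trunc; lia. Qed.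

(** The exponents of x1 in (x1 - x2)^k A are bounded below because those of B
    are. *)
Lemma cleared_trunc_l (b c : int) : b <= B0 -> cleared A k b c = 0.
Proof.
move=> bB; rewrite AB_comm /cleared bsum_nat big1 // => i _.
rewrite B_trunc ?scaler0 //.
by have := leq_mul (leqnn p) (ltnSE (ltn_ord i)); lia.
Qed.

(** The Jacobi identity multiplied by x0^k, for exponents of x1 so negative that
    B does not contribute. *)
Lemma cleared_jacobi (a b c : int) : b <= B0 ->
  bsum (- a%:~R - 1) (-1) (fun i =>
    cleared A k (b + p%:Z * (a + 1) + (p * i)%:Z) (c - (p * i)%:Z))
  = p%:R^-1 *: \sum_(0 <= r < p) (w ^+ r) ^ b *:
      bsum (- (b%:~R / p%:R) - 1) 1
        (fun j => H r (a - k%:Z - j%:Z) (c + p%:Z + b + (p * j)%:Z)).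
Proof.
move=> bB; rewrite -jacobi [X in _ - _ *: X]bsum_0 ?scaler0 ?subr0; last first.
  by move=> i; apply: B_trunc; lia.
have -> : - (a - k%:Z)%:~R - 1 = (- a%:~R - 1) + k%:R :> F by ring.
rewrite -(@bsum_bsum _ _ (- a%:~R - 1) k%:R _ _ `|c - C0|%N) => [|i ci]; last first.
  by apply: A_trunc; nia.
apply: eq_bsum => i; apply: eq_bsum => j.
by congr (A _ _); lia.
Qed.

(** The left-hand side of [cleared_jacobi] is the coefficient of
    x0^a x2^(c/p) in the sum over m >= 0 of (x2 + x0)^m F_(b + p + pm)(x2), where
    F_b(x2) is the coefficient of x1^(b/p) in (x1 - x2)^k A. *)
Lemma cleared_residue (a b c : int) (N : nat) : b <= B0 ->
  (forall m, (N <= m)%N -> c + p%:Z * (a + 1) - (p * m)%:Z <= C0) ->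
  bsum (- a%:~R - 1) (-1) (fun i =>
    cleared A k (b + p%:Z * (a + 1) + (p * i)%:Z) (c - (p * i)%:Z))
  = if a is Posz n then \sum_(m < N) 'C(m, n)%:R *:
      cleared A k (b + p%:Z + (p * m)%:Z) (c + (p * n)%:Z - (p * m)%:Z)
    else 0.
Proof.
move=> bB cN; case: a cN => n cN.
  rewrite -(@bsum_upper_neg _ _ n (fun m => cleared A k (b + p%:Z + (p * m)%:Z)
    (c + (p * n)%:Z - (p * m)%:Z)) N); last first.
    by move=> m /cN mN; apply: cleared_trunc_r; lia.
  by apply: eq_bsum => i; congr (cleared A k _ _); lia.
have -> : - (Negz n)%:~R - 1 = n%:R :> F.
  by rewrite NegzE mulrNz opprK -pmulrn -natr1 addrK.
rewrite bsum_nat big1 // => i _; rewrite cleared_trunc_l ?scaler0 //.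
by have := ltnSE (ltn_ord i); rewrite NegzE; nia.
Qed.

(** [cleared_jacobi] multiplied by (x2 + x0)^(b/p + 1), the inverse of the power
    of the binomial on its right-hand side. *)
Lemma cleared_component (a b c : int) (N : nat) : b <= B0 ->
  (forall m, (N <= m)%N -> c + p%:Z * a - b - (p * m)%:Z <= C0) ->
  p%:R^-1 *: \sum_(0 <= r < p) (w ^+ r) ^ b *: H r (a - k%:Z) c
  = if a is Posz n then \sum_(m < N)
      let b' := b + p%:Z + (p * m)%:Z in
      gbinom (b'%:~R / p%:R) n *: cleared A k b' (c + (p * n)%:Z - b')
    else 0.
Proof.
move=> bB cN; pose q : F := b%:~R / p%:R.
pose d : int := a - k%:Z - A0.
(* The coefficients met by all the sums below; they vanish from `|d| on. *)
pose h r (l : nat) := H r (a - k%:Z - l%:Z) (c + (p * l)%:Z).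
have hN r l : (r < p)%N -> (`|d| <= l)%N -> h r l = 0.
  by move=> rp al; apply: H_trunc => //; lia.
(* The exponents q + 1 and - q - 1 of the two binomials cancel. *)
transitivity (bsum (q + 1) 1 (fun j : nat => p%:R^-1 *:
    \sum_(0 <= r < p) (w ^+ r) ^ b *: bsum (- q - 1) 1 (fun i => h r (j + i)%N))).
  rewrite (@bsum_scale_sum _ _ _ _ `|d|%N); last first.
    by move=> r i rp Ni; apply: bsum_0 => j; apply: hN => //; lia.
  congr (_ *: _); apply: eq_big_nat => r /andP[_ rp].
  rewrite (@bsum_bsum _ _ _ _ _ _ `|d|%N); last first.
    by move=> i; apply: hN.
  have -> : q + 1 + (- q - 1) = 0 by ring.
  by rewrite bsum_eq0l /h; congr (_ *: H _ _ _); lia.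
transitivity (bsum (q + 1) 1 (fun j : nat =>
    if a - j%:Z is Posz n then \sum_(m < N) 'C(m, n)%:R *:
      cleared A k (b + p%:Z + (p * m)%:Z)
        (c - p%:Z - b + (p * j)%:Z + (p * n)%:Z - (p * m)%:Z)
    else 0)).
  apply: eq_bsum => j; rewrite -cleared_residue //; last first.
    by move=> m /cN mN; lia.
  rewrite cleared_jacobi //; congr (_ *: _); apply: eq_bigr => r _.
  by congr (_ *: _); apply: eq_bsum => i; rewrite /h; congr (H _ _ _); lia.
case: a {d hN h cN} => n; last first.
  by apply: bsum_0 => j; rewrite !NegzE -opprD; case: (j) => [|j'] //.
rewrite (@bsum_trunc _ _ _ _ _ n.+1) => [|j nj]; last first.
  have -> : Posz n - Posz j = Negz (j - n.+1) by lia.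
  by [].
under eq_bigr => j _.
  have jn := ltnSE (ltn_ord j).
  rewrite subzn // scaler_sumr.
  over.
rewrite exchange_big; apply: eq_bigr => m _ /=.
(* The argument of [cleared] does not depend on j, so that Vandermonde applies. *)
transitivity (\sum_(j < n.+1) (gbinom (q + 1) j * gbinom m%:R (n - j)) *:
    cleared A k (b + p%:Z + (p * m)%:Z)
      (c + (p * n)%:Z - (b + p%:Z + (p * m)%:Z))).
  apply: eq_bigr => j _; have jn := ltnSE (ltn_ord j).
  rewrite scalerA expr1n mulr1 gbinom_nat; congr (_ *: cleared _ _ _ _).
  have: (p * j + p * (n - j))%N = (p * n)%N by rewrite -mulnDr subnKC.
  lia.
rewrite -scaler_suml gbinom_vandermonde; congr (gbinom _ _ *: _).
have p0 : p%:R != 0 :> F by rewrite pnatr_eq0 -lt0n.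
rewrite /q !intrD -!pmulrn natrM; field; exact: p0.
Qed.

Hypothesis w_prim : p.-primitive_root w.

(** [cleared_component] summed over b = b0, ..., b0 + p - 1 with weights
    w^(s b), which depend on b mod p only: the exponents b + p + p m of x1 then
    cover once every integer from b0 + p on, and [cleared] vanishes at the smaller
    ones. *)
Lemma cleared_limit (s : int) (r0 : nat) (a c : int) :
  (r0 < p)%N -> w ^+ r0 * w ^ s = 1 ->
  H r0 (a - k%:Z) c
  = if a is Posz n then \sum_(b \in [set: int])
      (w ^ (s * b) * gbinom (b%:~R / p%:R) n)
        *: cleared A k b (c + (p * n)%:Z - b)
    else 0.
Proof.
move=> r0p r0s.
have p0 : p%:R != 0 :> F by rewrite pnatr_eq0 -lt0n.
have w_unit : w != 0 by rewrite (prim_root_eq0 w_prim) -lt0n.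
pose z r := w ^+ r * w ^ s.
have z_unit r : z r \is a GRing.unit.
  by rewrite unitfE mulf_neq0 ?expf_neq0 ?expfz_neq0.
have zp r : z r ^+ p = 1.
  rewrite exprMn -exprM mulnC exprM (prim_expr_order w_prim) expr1n mul1r.
  by rewrite exprnP exprzAC -exprnP (prim_expr_order w_prim) exp1rz.
have sum_z r : (r < p)%N -> \sum_(i < p) z r ^+ i = (r == r0)%:R * p%:R.
  move=> rp; have [->|rr0] := eqVneq r r0.
    under eq_bigr => i _ do rewrite /z r0s expr1n.
    by rewrite sumr_const card_ord mul1r.
  (* z r = 1 forces w^r = w^r0. *)
  rewrite mul0r; apply: sum_unity_root => //; apply: contra rr0 => /eqP zr1.
  have ws0 : w ^ s != 0 by rewrite expfz_neq0.
  have : w ^+ r == w ^+ r0 by apply/eqP/(mulIf ws0); rewrite r0s.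
  by rewrite (eq_prim_root_expr w_prim) !modn_small.
have filter_r (b0 : int) r : (0 <= r < p)%N ->
  \sum_(0 <= i < p) (w ^ (s * (b0 + i%:Z)) / p%:R) *:
    ((w ^+ r) ^ (b0 + i%:Z) *: H r (a - k%:Z) c)
  = (r == r0)%:R *: H r (a - k%:Z) c.
  move=> /andP[_ rp]; transitivity ((p%:R^-1 * z r ^ b0 * \sum_(i < p) z r ^+ i)
    *: H r (a - k%:Z) c).
    rewrite big_mkord mulr_sumr scaler_suml; apply: eq_bigr => i _.
    rewrite scalerA; congr (_ *: _).
    have -> : p%:R^-1 * z r ^ b0 * z r ^+ i = p%:R^-1 * z r ^ (b0 + i%:Z).
      by rewrite -mulrA exprzDr.
    rewrite exprzMl ?unitfE ?expf_neq0 ?expfz_neq0 // exprz_exp.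
    by rewrite mulrC mulrA mulrC.
  rewrite sum_z //; have [->|] := eqVneq r r0; last by rewrite mul0r mulr0.
  by rewrite /z r0s exp1rz mulr1 mul1r mulVf.
(* All the exponents b0 + i with i < p are at most B0, and every sum over m can
   be cut off at `|d|, uniformly in i. *)
pose b0 : int := B0 - p%:Z; pose d : int := c + p%:Z * a - b0 - C0.
transitivity (\sum_(0 <= i < p) w ^ (s * (b0 + i%:Z)) *: (p%:R^-1 *:
    \sum_(0 <= r < p) (w ^+ r) ^ (b0 + i%:Z) *: H r (a - k%:Z) c)).
  under eq_bigr => i _ do rewrite scalerA scaler_sumr.
  rewrite exchange_big /= (eq_big_nat _ _ (filter_r b0)) big_mkord.
  rewrite (bigD1 (Ordinal r0p)) //= eqxx scale1r big1 ?addr0 // => r rr0.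
  by rewrite -val_eqE /= in rr0; rewrite (negPf rr0) scale0r.
transitivity (\sum_(0 <= i < p) w ^ (s * (b0 + i%:Z)) *:
    if a is Posz n then \sum_(m < `|d|)
      let b' := b0 + i%:Z + p%:Z + (p * m)%:Z in
      gbinom (b'%:~R / p%:R) n *: cleared A k b' (c + (p * n)%:Z - b')
    else 0).
  apply: eq_big_nat => i /andP[_ ip]; rewrite -(@cleared_component _ _ _ `|d|%N) //.
    by rewrite /b0; lia.
  by move=> m; rewrite /d; nia.
case: a {filter_r} @d => n d; last by rewrite big1 // => i _; rewrite scaler0.
rewrite (@intsum_trunc _ _ _ (b0 + p%:Z) (`|d| * p)) //.
- rewrite big_nat_mul big_mkord.
  under [RHS]eq_bigr => m _ do
    rewrite -[X in index_iota X]add0n big_addn mulSn addnK big_mkord.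
  rewrite exchange_big /= big_mkord; apply: eq_bigr => i _.
  rewrite scaler_sumr; apply: eq_bigr => m _.
  have -> : b0 + p%:Z + (i + m * p)%N%:Z = b0 + i%:Z + p%:Z + (p * m)%:Z by lia.
  rewrite scalerA; congr (_ * _ *: _).
  have -> : s * (b0 + i%:Z + p%:Z + (p * m)%:Z)
    = s * (b0 + i%:Z) + p%:Z * (s * (1 + m%:Z)) by lia.
  rewrite exprzDr ?unitfE // -(exprz_exp w p%:Z) -exprnP (prim_expr_order w_prim).
  by rewrite exp1rz mulr1.
- move=> b bl; rewrite cleared_trunc_l ?scaler0 //; lia.
- move=> b bl; rewrite cleared_trunc_r ?scaler0 //; nia.
Qed.

End Cleared.
End JacobiCoefficients.

(** * Exponents of formal monomials *)

Section Exponents.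
Implicit Types (m n a b c : int) (k p : nat).

Lemma expo_add a b c a' b' c' :
  (a, b, c) + (a', b', c') = (a + a', b + b', c + c') :> expo.
Proof. by []. Qed.

Lemma expo_opp a b c : - ((a, b, c) : expo) = (- a, - b, - c).
Proof. by []. Qed.

Lemma expo_muln a b c k : ((a, b, c) : expo) *+ k = (a *+ k, b *+ k, c *+ k).
Proof. by elim: k => // k IH; rewrite !mulrSr IH. Qed.

Lemma expo_mulz a b c m : ((a, b, c) : expo) *~ m = (a * m, b * m, c * m).
Proof.
have mulnE (d : int) k : d *+ k = d * k%:Z by rewrite -mulr_natr natz.
case: m => k; first by rewrite -pmulrn expo_muln !mulnE.
by rewrite NegzE mulrNz -pmulrn expo_muln !mulnE !mulrN.
Qed.

Definition expoE :=
  (expo_add, expo_opp, expo_muln, expo_mulz, mul0rn, mul0r, mul1r,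
   add0r, addr0, oppr0).

Lemma expo_x0n k : x0 *+ k = (k%:Z, 0, 0).
Proof. by rewrite /x0 expo_muln !mul0rn natz. Qed.

Lemma expo_x0z m : x0 *~ m = (m, 0, 0).
Proof. by rewrite /x0 expo_mulz !mul0r mul1r. Qed.

Lemma expo_x1rz m : x1root *~ m = (0, m, 0).
Proof. by rewrite /x1root expo_mulz !mul0r mul1r. Qed.

Lemma expo_x2rz m : x2root *~ m = (0, 0, m).
Proof. by rewrite /x2root expo_mulz !mul0r mul1r. Qed.

Lemma expo_x1 p : x1 p = (0, p%:Z, 0).
Proof. by rewrite /x1 /x1root expo_muln !mul0rn natz. Qed.

Lemma expo_x2 p : x2 p = (0, 0, p%:Z).
Proof. by rewrite /x2 /x2root expo_muln !mul0rn natz. Qed.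

Lemma expo_x1n p k : x1 p *+ k = (0, (p * k)%:Z, 0).
Proof. by rewrite expo_x1 expo_muln !mul0rn -mulr_natr natz. Qed.

Lemma expo_x2n p k : x2 p *+ k = (0, 0, (p * k)%:Z).
Proof. by rewrite expo_x2 expo_muln !mul0rn -mulr_natr natz. Qed.

End Exponents.

(** * Products with binomial series and delta functions *)

Section Series.
Variable F : numFieldType.

Lemma fsum_reindex (V : nmodType) (I J : choiceType) (h : I -> J) (f : J -> V) :
  injective h -> (forall j, f j != 0 -> exists i, j = h i) ->
  \sum_(j \in [set: J]) f j = \sum_(i \in [set: I]) f (h i).
Proof.
move=> h_inj fh; rewrite -(fsbig_widen (range h)) //; last first.
  move=> j [_ /= jh]; apply: contrapT => /eqP fj0; apply: jh.
  by have [i ->] := fh j fj0; exists i.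
by apply: reindex_fsbig; apply: inj_bij => i j _ _ /h_inj.
Qed.

(** As x is nonzero, both sums have the same support, be it finite or not. *)
Lemma scaler_fsum (V : lmodType F) (I : choiceType) (x : F) (f : I -> V) :
  x != 0 ->
  x *: \sum_(i \in [set: I]) f i = \sum_(i \in [set: I]) x *: f i.
Proof.
move=> x0.
have supp : ((fun i => x *: f i) @^-1` [set~ 0] = f @^-1` [set~ 0])%classic.
  apply/seteqP; split=> i /= /eqP xf; apply/eqP; move: xf;
    by rewrite scaler_eq0 negb_or x0.
have -> : finite_support 0 [set: I] (fun i => x *: f i)
    = finite_support 0 [set: I] f.
  by rewrite /finite_support !unlock supp.
by rewrite scaler_sumr.
Qed.

Lemma binpow_at p n xr y (c : F) k :
  injective (fun k : nat => xr *~ (n - (p * k)%:Z) + y *+ k) ->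
  binpow p n xr y c (xr *~ (n - (p * k)%:Z) + y *+ k)
  = gbinom (n%:~R / p%:R) k * c ^+ k.
Proof.
move=> inj; rewrite /binpow.
rewrite (_ : [set j : nat | _]%classic = [set k]%classic) ?fsbig_set1 //.
by apply/seteqP; split=> [j /inj|j ->].
Qed.

Lemma binpow_supp p n xr y (c : F) e : binpow p n xr y c e != 0 ->
  exists k : nat, e = xr *~ (n - (p * k)%:Z) + y *+ k.
Proof.
move=> nz; apply: contrapT => nex; case/eqP: nz; apply: fsbig1 => k /= ek.
by case: nex; exists k.
Qed.

Lemma fdelta_supp p q (c : F) xr y z e : fdelta p q c xr y z e != 0 ->
  exists n (k : nat), e + z *~ n = xr *~ (n * q%:Z - (p * k)%:Z) + y *+ k.
Proof.
move=> nz; apply: contrapT => nex; case/eqP: nz; apply: fsbig1 => n _.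
have [->|/binpow_supp[k ek]] :=
  eqVneq (binpow p (n * q%:Z) xr y (-1) (e + z *~ n)) (0 : F).
  by rewrite mulr0.
by case: nex; exists n, k.
Qed.

(** The sum defining the delta function reduces to its term [n] at an exponent
    [e] which determines [n]. *)
Lemma fdelta_at p q (c : F) xr y z e n :
  (forall m (k : nat),
    e + z *~ m = xr *~ (m * q%:Z - (p * k)%:Z) + y *+ k -> m = n) ->
  fdelta p q c xr y z e = c ^ n * binpow p (n * q%:Z) xr y (-1) (e + z *~ n).
Proof.
move=> uniq_n; rewrite /fdelta -(fsbig_widen [set n]%classic) ?fsbig_set1 //.
move=> m [_ /= mn].
have [->|/binpow_supp[k ek]] :=
  eqVneq (binpow p (m * q%:Z) xr y (-1) (e + z *~ m)) (0 : F).
  by rewrite mulr0.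
by case: mn; apply: uniq_n ek.
Qed.

Variable M : lmodType F.

(** A product of series as a sum over one natural number, when the
    exponents of [f] that contribute are parametrized by [h]. *)
Lemma fmul_param (f : series F) (g : series M) e (h : nat -> expo) :
  injective h ->
  (forall t, f t != 0 -> g (e - t) != 0 -> exists k, t = h k) ->
  fmul f g e = \sum_(k \in [set: nat]) f (h k) *: g (e - h k).
Proof.
move=> h_inj fg; apply: fsum_reindex => // t.
by rewrite scaler_eq0 negb_or => /andP[]; apply: fg.
Qed.

Variables (p : nat) (p_gt0 : (0 < p)%N).

Lemma binpow_x1x2 n (d : F) k :
  binpow p n x1root (x2 p) d (0, n - (p * k)%:Z, (p * k)%:Z)
  = gbinom (n%:~R / p%:R) k * d ^+ k.
Proof.
rewrite -(@binpow_at p n x1root (x2 p)); first by rewrite expo_x1rz expo_x2n !expoE.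
by move=> i j; rewrite !expo_x1rz !expo_x2n !expoE => -[]; nia.
Qed.

Lemma binpow_x2x1 n (d : F) k :
  binpow p n x2root (x1 p) d (0, (p * k)%:Z, n - (p * k)%:Z)
  = gbinom (n%:~R / p%:R) k * d ^+ k.
Proof.
rewrite -(@binpow_at p n x2root (x1 p)); first by rewrite expo_x2rz expo_x1n !expoE.
by move=> i j; rewrite !expo_x2rz !expo_x1n !expoE => -[]; nia.
Qed.

Lemma binpow_x1x0 n (d : F) k :
  binpow p n x1root x0 d (k%:Z, n - (p * k)%:Z, 0)
  = gbinom (n%:~R / p%:R) k * d ^+ k.
Proof.
rewrite -(@binpow_at p n x1root x0); first by rewrite expo_x1rz expo_x0n !expoE.
by move=> i j; rewrite !expo_x1rz !expo_x0n !expoE => -[]; nia.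
Qed.

Lemma binpow_x2x0 n (d : F) k :
  binpow p n x2root x0 d (k%:Z, 0, n - (p * k)%:Z)
  = gbinom (n%:~R / p%:R) k * d ^+ k.
Proof.
rewrite -(@binpow_at p n x2root x0); first by rewrite expo_x2rz expo_x0n !expoE.
by move=> i j; rewrite !expo_x2rz !expo_x0n !expoE => -[]; nia.
Qed.

Lemma fmul_binpow_x1x2 n (d : F) (g : series M) a b c :
  fmul (binpow p n x1root (x2 p) d) g (a, b, c)
  = bsum (n%:~R / p%:R) d
      (fun i => g (a, b - n + (p * i)%:Z, c - (p * i)%:Z)).
Proof.
rewrite (fmul_param (h := fun k : nat => (0, n - (p * k)%:Z, (p * k)%:Z))).
- apply: eq_fsbigr => k _; rewrite binpow_x1x2; congr (_ *: g _).
  by rewrite !expoE /=; congr (_, _, _) => /=; lia.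
- by move=> i j [_ ]; nia.
- by move=> t /binpow_supp[k ->] _; exists k; rewrite expo_x1rz expo_x2n !expoE.
Qed.

Lemma int_div_p (m : int) : (m * p%:Z)%:~R / p%:R = m%:~R :> F.
Proof.
by rewrite intrM -[p%:~R]pmulrn mulfK // pnatr_eq0 -lt0n.
Qed.

(** In the next three lemmas, [g] involves only two of the three variables, so
    that its exponents single out one term of the delta function. *)
Lemma fmul_delta_x1x2 (g : series M) a b c :
  (forall a b c, a != 0 -> g (a, b, c) = 0) ->
  fmul (xmul (- x0) (fdelta p p 1 x1root (x2 p) x0)) g (a, b, c)
  = bsum (- a%:~R - 1) (-1) (fun i =>
      g (0, b + p%:Z * (a + 1) + (p * i)%:Z, c - (p * i)%:Z)).
Proof.
move=> g0; pose n := - a - 1.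
rewrite (fmul_param (h := fun k : nat => (a, n * p%:Z - (p * k)%:Z, (p * k)%:Z))).
- apply: eq_fsbigr => k _; rewrite /xmul opprK.
  rewrite (@fdelta_at _ _ _ _ _ _ _ n).
    rewrite exp1rz mul1r expo_x0z /x0 !expoE.
    have -> : a + 1 + n = 0 by rewrite /n; lia.
    rewrite binpow_x1x2 int_div_p; congr (gbinom _ _ * _ *: g _).
      by rewrite /n intrD !mulrNz.
    by rewrite subrr; congr (_, _, _) => /=; rewrite /n; lia.
  move=> m j; rewrite expo_x0z expo_x1rz expo_x2n /x0 !expoE => -[] + _ _.
  by rewrite /n; lia.
- by move=> i j [_ ]; nia.
move=> [[ta tb] tc]; rewrite /xmul opprK => /fdelta_supp[m [k]].
rewrite expo_x0z expo_x1rz expo_x2n /x0 !expoE => -[ta_m -> ->].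
have [at0|at0] := eqVneq (a - ta) 0; last by rewrite g0 ?eqxx.
by move=> _; exists k; congr (_, _, _) => /=; rewrite ?/n; lia.
Qed.

Lemma fmul_delta_x2x1 (g : series M) a b c :
  (forall a b c, a != 0 -> g (a, b, c) = 0) ->
  fmul (xmul (- x0) (fdelta p p (-1) x2root (x1 p) x0)) g (a, b, c)
  = (-1) ^ (- a - 1) *: bsum (- a%:~R - 1) (-1) (fun i =>
      g (0, b - (p * i)%:Z, c + p%:Z * (a + 1) + (p * i)%:Z)).
Proof.
move=> g0; pose n := - a - 1.
rewrite (fmul_param (h := fun k : nat => (a, (p * k)%:Z, n * p%:Z - (p * k)%:Z))).
- rewrite scaler_fsum ?expfz_neq0 ?oppr_eq0 ?oner_eq0 //.
  apply: eq_fsbigr => k _; rewrite /xmul opprK.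
  rewrite (@fdelta_at _ _ _ _ _ _ _ n).
    rewrite expo_x0z /x0 !expoE.
    have -> : a + 1 + n = 0 by rewrite /n; lia.
    rewrite binpow_x2x1 int_div_p scalerA; congr (_ * (gbinom _ _ * _) *: g _).
      by rewrite /n intrD !mulrNz.
    by rewrite subrr; congr (_, _, _) => /=; rewrite /n; lia.
  move=> m j; rewrite expo_x0z expo_x2rz expo_x1n /x0 !expoE => -[] + _ _.
  by rewrite /n; lia.
- by move=> i j []; nia.
move=> [[ta tb] tc]; rewrite /xmul opprK => /fdelta_supp[m [k]].
rewrite expo_x0z expo_x2rz expo_x1n /x0 !expoE => -[ta_m -> ->].
have [at0|at0] := eqVneq (a - ta) 0; last by rewrite g0 ?eqxx.
by move=> _; exists k; congr (_, _, _) => /=; rewrite ?/n; lia.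
Qed.

Lemma fmul_delta_x1x0 (d : F) (g : series M) a b c :
  d ^+ p = 1 -> (forall a b c, b != 0 -> g (a, b, c) = 0) ->
  fmul (xmul (- x2 p) (fdelta p 1 d x1root x0 x2root)) g (a, b, c)
  = d ^ b *: bsum (- (b%:~R / p%:R) - 1) 1 (fun j =>
      g (a - j%:Z, 0, c + p%:Z + b + (p * j)%:Z)).
Proof.
move=> dp g0; pose n (k : nat) := b + (p * k)%:Z.
have d0 : d != 0.
  by apply: contra_eq_neq dp => ->; rewrite expr0n gtn_eqF // eq_sym oner_eq0.
have p0 : p%:R != 0 :> F by rewrite pnatr_eq0 -lt0n.
rewrite (fmul_param (h := fun k : nat => (k%:Z, b, - n k - p%:Z))).
- rewrite scaler_fsum ?expfz_neq0 //.
  apply: eq_fsbigr => k _; rewrite /xmul opprK.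
  rewrite (@fdelta_at _ _ _ _ _ _ _ (n k)).
    rewrite expo_x2rz expo_x2 mulr1 !expoE.
    have -> : - n k - p%:Z + p%:Z + n k = 0 by lia.
    have {2}-> : b = n k - (p * k)%:Z by rewrite /n; lia.
    rewrite binpow_x1x0 scalerA; congr (_ *: g _); last first.
      by rewrite subrr; congr (_, _, _) => /=; rewrite /n; lia.
    rewrite {1}/n expfzDr // PoszM -(exprz_exp d p%:Z) -[d ^ p%:Z]exprnP dp.
    rewrite exp1rz mulr1.
    congr (_ * _); rewrite expr1n mulr1.
    have -> : (n k)%:~R / p%:R = b%:~R / p%:R + k%:R :> F.
      by rewrite /n intrD -pmulrn natrM; field.
    by rewrite -gbinom_neg -mulrA -expr2 sqrr_sign mulr1.
  move=> m j; rewrite expo_x2rz expo_x1rz expo_x0n expo_x2 !expoE mulr1 => -[].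
  by rewrite /n; lia.
- by move=> i j []; nia.
move=> [[ta tb] tc]; rewrite /xmul opprK => /fdelta_supp[m [k]].
rewrite expo_x2rz expo_x1rz expo_x0n expo_x2 !expoE => -[-> tbm tcm].
have [at0|at0] := eqVneq (b - tb) 0; last by rewrite g0 ?eqxx.
by move=> _; exists k; congr (_, _, _) => /=; rewrite ?/n; lia.
Qed.

End Series.

(** * Powers of the automorphism *)

Section Automorphisms.
Variables (F : numFieldType) (V : lmodType F) (A : voa V) (nu : voa_aut A).
Variables (p : nat) (w : F).
Hypotheses (p_gt0 : (0 < p)%N) (w_prim : p.-primitive_root w).
Hypothesis nu_p : forall v, iter p nu v = v.

Lemma iter_aut_mod n u : iter (n %% p) nu u = iter n nu u.
Proof.
rewrite [in RHS](divn_eq n p) addnC iterD; congr (iter _ _ _).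
by elim: (n %/ p)%N => // q IH; rewrite mulSn iterD nu_p.
Qed.

Lemma iter_aut_inv n u : iter n (aut_inv nu) u = iter (n * p.-1) nu u.
Proof.
elim: n => // n IH; rewrite mulSn iterD /= IH; set x := iter _ _ _.
by rewrite -[in LHS](nu_p x) -(prednK p_gt0) /= autK.
Qed.

(** As nu and [w] both have order dividing [p], r is - s modulo [p]. *)
Lemma aut_pow_opp s u : exists r,
  [/\ (r < p)%N, w ^+ r * w ^ s = 1 & aut_pow nu (- s) u = iter r nu u].
Proof.
have w_neq0 : w != 0 by rewrite (prim_root_eq0 w_prim) -lt0n.
case: (intP s) => [|n|n].
- by exists 0%N; rewrite p_gt0 mulr1.
- exists ((n.+1 * p.-1) %% p)%N; rewrite ltn_mod p_gt0; split=> //.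
    rewrite (prim_expr_mod w_prim) -exprnP -exprD addnC -mulnS prednK //.
    by rewrite mulnC exprM (prim_expr_order w_prim) expr1n.
  by rewrite iter_aut_mod -iter_aut_inv -NegzE.
exists (n.+1 %% p)%N; rewrite ltn_mod p_gt0; split=> //.
  rewrite (prim_expr_mod w_prim) -exprz_inv -exprnP -exprMn divff //.
  by rewrite expr1n.
by rewrite iter_aut_mod opprK.
Qed.

End Automorphisms.

(** * The formal limit *)

Section Limit.
Variables (F : numFieldType) (M : lmodType F) (p : nat) (w : F) (s : int).
Hypothesis p_gt0 : (0 < p)%N.
Variables (C : int -> int -> M) (B0 C0 : int).
Hypothesis C_trunc_l : forall b c : int, b <= B0 -> C b c = 0.
Hypothesis C_trunc_r : forall b c : int, c <= C0 -> C b c = 0.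
Variable f : series M.
Hypothesis fE : forall a b c, f (a, b, c) = if a == 0 then C b c else 0.

(** The monomial x1^(b/p) x2^(c/p) contributes to x0^n x2^(c'/p) only if
    b + c = c' + p n; as b and c are bounded below, finitely many do. *)
Lemma lim_term_supp e t : lim_term p w s f e t != 0 ->
  exists n : nat, exists b : int, [/\ e.1 = (n%:Z, 0),
    t = (0, b, e.2 + (p * n)%:Z - b), B0 < b & C0 < e.2 + (p * n)%:Z - b].
Proof.
case: e t => -[a' b'] c' [[a b] c]; rewrite /lim_term fE.
have [->|] := eqVneq a 0; last by rewrite scaler0 eqxx.
rewrite scaler_eq0 mulf_eq0 !negb_or -andbA => /and3P[_ /binpow_supp[n] /eqP].
rewrite expo_x2rz expo_x0n !expoE -/(_ = _) => /eqP[-> -> c_eq] nz.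
have {c_eq}c_eq : c = c' + (p * n)%:Z - b by lia.
rewrite c_eq in nz *; exists n, b; split=> //=.
  by have [/C_trunc_l C0'|//] := lerP b B0; rewrite C0' eqxx in nz.
by have [/C_trunc_r C0'|//] := lerP _ C0; rewrite C0' eqxx in nz.
Qed.

Lemma lim_term_at n b c :
  lim_term p w s f (n%:Z, 0, c) (0, b, c + (p * n)%:Z - b)
  = (w ^ (s * b) * gbinom (b%:~R / p%:R) n) *: C b (c + (p * n)%:Z - b).
Proof.
rewrite /lim_term fE eqxx /xmul !expoE /=; congr (_ * _ *: _).
have -> : c - (c + (p * n)%:Z - b) = b - (p * n)%:Z by lia.
by rewrite binpow_x2x0 // expr1n mulr1.
Qed.

(** A series with exponents of x1 and x2 bounded below has a formal limit, whose
    coefficients are those of sum_b w^(s b) (x2 + x0)^(b/p) C_b(x2). *)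
Lemma formal_lim (g : series M) :
  (forall a b c, b != 0 -> g (a, b, c) = 0) ->
  (forall a c, g (a, 0, c) = if a is Posz n then \sum_(b \in [set: int])
     (w ^ (s * b) * gbinom (b%:~R / p%:R) n) *: C b (c + (p * n)%:Z - b)
   else 0) ->
  is_formal_lim p w s f g.
Proof.
move=> g0 gE [[a b] c].
have [->|b0] := eqVneq b 0; last first.
  have t0 t : lim_term p w s f (a, b, c) t = 0.
    apply: contra_neq_eq b0 => /lim_term_supp[n [b' [[_ ->]]]] //.
  rewrite g0 //; split; last exact: fsbig1.
  rewrite (_ : [set t | _]%classic = set0) // -subset0 => t /=.
  by rewrite t0 eqxx.
rewrite gE; case: a => n; last first.
  have t0 t : lim_term p w s f (Negz n, 0, c) t = 0.
    by apply/eqP; apply: contraT => /lim_term_supp[m [b' []]].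
  split; last exact: fsbig1.
  rewrite (_ : [set t | _]%classic = set0) // -subset0 => t /=.
  by rewrite t0 eqxx.
pose h (b' : int) : expo := (0, b', c + (p * n)%:Z - b').
split.
  pose d : int := c + (p * n)%:Z - C0 - B0; pose N := `|d|%N.
  pose h' (i : nat) := h (B0 + i%:Z).
  apply: (sub_finite_set _ (finite_image h' (finite_II N))).
  move=> t /= /lim_term_supp[m [b' [[<-] -> /= Bb Cb]]].
  exists `|b' - B0|%N; rewrite /= /N /d; first by lia.
  by rewrite /h' /h; congr (_, _, _); lia.
rewrite (@fsum_reindex _ _ _ h) => [|i j [] //|t].
  by apply: eq_fsbigr => b' _; apply: lim_term_at.
by move=> /lim_term_supp[m [b' [[nm] -> _ _]]]; exists b'; rewrite /h nm.
Qed.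

End Limit.

(** * Twisted modules *)

Section TwistedModule.
Variables (F : numFieldType) (V : lmodType F) (A : voa V) (p : nat) (wp : F).
Hypotheses (p_gt0 : (0 < p)%N) (wp_prim : p.-primitive_root wp).
Variables (nu : voa_aut A) (M : lmodType F) (YM : vertex_map V M).
Hypothesis YM_trunc : truncation p YM.
Hypothesis YM_jacobi : twisted_jacobi nu p wp YM.
Hypothesis YM_linear : vmap_linear YM.
Variables (u v : V).

(** The coefficients of x1^(b/p) x2^(c/p) in the two products, and those of
    x0^a x2^(c/p) in the iterates. *)
Definition prod12 (m : M) (b c : int) : M := YM u b (YM v c m).
Definition prod21 (m : M) (b c : int) : M := YM v c (YM u b m).
Definition iterate (m : M) (r : nat) (a c : int) : M :=
  YM (vY A (iter r nu u) a v) c m.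

Lemma prod12_trunc m : exists C0 : int, forall b c, c <= C0 -> prod12 m b c = 0.
Proof.
have [N YN] := YM_trunc v m; exists (- N - p%:Z) => b c cN.
have := YN (- c - p%:Z); rewrite /mode /prod12.
have -> : - (- c - p%:Z) - p%:Z = c by ring.
by move=> ->; rewrite ?linear0 //; lia.
Qed.

Lemma prod21_trunc m : exists B0 : int, forall b c, b <= B0 -> prod21 m b c = 0.
Proof.
have [N YN] := YM_trunc u m; exists (- N - p%:Z) => b c bN.
have := YN (- b - p%:Z); rewrite /mode /prod21.
have -> : - (- b - p%:Z) - p%:Z = b by ring.
by move=> ->; rewrite ?linear0 //; lia.
Qed.

(** The bound comes from the truncation in V: it does not depend on [m], which
    makes k(u,v) well defined. *)
Lemma iterate_trunc : exists A0 : int, forall m r a c,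
  (r < p)%N -> a <= A0 -> iterate m r a c = 0.
Proof.
have bound n : exists A0 : int, forall r a,
    (r < n)%N -> a <= A0 -> vY A (iter r nu u) a v = 0.
  elim: n => [|n [A1 IH]]; first by exists 0.
  have [N YN] := vY_trunc A (iter n nu u) v.
  exists (- `|A1| - `|N| - 1) => r a; rewrite ltnS leq_eqVlt.
  move=> /orP[/eqP ->|rn] aA; last by apply: IH => //; lia.
  have := YN (- a - 1%:Z); rewrite /mode.
  have -> : - (- a - 1%:Z) - 1%:Z = a by ring.
  by apply; lia.
have [A0 YA0] := bound p; exists A0 => m r a c rp aA.
have := YM_linear c m (- 1) 0 0.
by rewrite /iterate YA0 // !scaleN1r oppr0 addr0 addNr.
Qed.

Lemma fmul_prod12 m k a b c :
  fmul (binpow p (p * k)%:Z x1root (x2 p) (-1)) (Y1Y2 YM u v m) (a, b, c)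
  = if a == 0 then cleared p (prod12 m) k b c else 0.
Proof.
rewrite fmul_binpow_x1x2 //.
have -> : (p * k)%:Z%:~R / p%:R = k%:R :> F by rewrite mulnC PoszM int_div_p.
have [->//|a0] := eqVneq a 0.
by apply: bsum_0 => i; rewrite /= (negPf a0).
Qed.

Lemma fmul_prod21 m k a b c :
  fmul (binpow p (p * k)%:Z x1root (x2 p) (-1)) (Y2Y1 YM u v m) (a, b, c)
  = if a == 0 then cleared p (prod21 m) k b c else 0.
Proof.
rewrite fmul_binpow_x1x2 //.
have -> : (p * k)%:Z%:~R / p%:R = k%:R :> F by rewrite mulnC PoszM int_div_p.
have [->//|a0] := eqVneq a 0.
by apply: bsum_0 => i; rewrite /= (negPf a0).
Qed.

Lemma weak_commP k : weak_comm p YM u v k <->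
  forall m b c, cleared p (prod12 m) k b c = cleared p (prod21 m) k b c.
Proof.
split=> [comm m b c|comm m].
  have := congr1 (fun f => f (0, b, c)) (comm m).
  by rewrite fmul_prod12 fmul_prod21.
apply/funext => -[[a b] c]; rewrite fmul_prod12 fmul_prod21.
by case: eqP.
Qed.

Lemma jacobi_coef m (a b c : int) :
  bsum (- a%:~R - 1) (-1)
    (fun i => prod12 m (b + p%:Z * (a + 1) + (p * i)%:Z) (c - (p * i)%:Z))
  - (-1) ^ (- a - 1) *: bsum (- a%:~R - 1) (-1)
    (fun i => prod21 m (b - (p * i)%:Z) (c + p%:Z * (a + 1) + (p * i)%:Z))
  = p%:R^-1 *: \sum_(0 <= r < p) (wp ^+ r) ^ b *:
      bsum (- (b%:~R / p%:R) - 1) 1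
        (fun j => iterate m r (a - j%:Z) (c + p%:Z + b + (p * j)%:Z)).
Proof.
have := congr1 (fun f => f (a, b, c)) (YM_jacobi u v m).
rewrite /jacobi_lhs fmul_delta_x1x2 // => [|a' b' c' /negPf /= -> //].
rewrite fmul_delta_x2x1 // => [|a' b' c' /negPf /= -> //].
move=> ->; congr (_ *: _); apply: eq_bigr => r _.
rewrite fmul_delta_x1x0 // => [|a' b' c' /negPf /= -> //].
by rewrite exprAC (prim_expr_order wp_prim) expr1n.
Qed.

Lemma comm_orderP : weak_comm p YM u v (comm_order p YM u v).
Proof.
have [A0 H_trunc] := iterate_trunc.
have comm : exists k, `[< weak_comm p YM u v k >].
  exists `|A0|%N; apply/asboolP/weak_commP => m b c.
  exact: (cleared_comm p_gt0 (H_trunc m) (jacobi_coef m)).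
rewrite /comm_order; case: xgetP => [k _ [] //|no_min].
case: (ex_minnP comm) => k /asboolP commk kmin; case: (no_min k).
by split=> // j /asboolP; apply: kmin.
Qed.

Lemma associativity_limit s m : let k := comm_order p YM u v in
  (forall v, iter p nu v = v) ->
  is_formal_lim p wp s
    (fmul (binpow p (p * k)%:Z x1root (x2 p) (-1)) (Y1Y2 YM u v m))
    (xmul (x0 *+ k) (Yiter (vY A) YM (aut_pow nu (- s) u) v m)).
Proof.
move=> k nu_p; have commk := (weak_commP k).1 comm_orderP m.
have [A0 H_trunc] := iterate_trunc.
have [B0 B_trunc] := prod21_trunc m; have [C0 A_trunc] := prod12_trunc m.
have [r [rp rs ->]] := aut_pow_opp p_gt0 wp_prim nu_p s u.
apply: (@formal_lim _ _ _ _ _ p_gt0 (cleared p (prod12 m) k) B0 C0).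
- by move=> b c; apply: (cleared_trunc_l p_gt0 B_trunc commk).
- by move=> b c; apply: (cleared_trunc_r p_gt0 A_trunc).
- exact: fmul_prod12.
- move=> a b c b0; rewrite /xmul expo_x0n expo_opp expo_add !oppr0 !addr0 /=.
  by rewrite (negPf b0).
move=> a c; rewrite /xmul expo_x0n expo_opp expo_add !oppr0 !addr0 /= ?eqxx.
exact: (cleared_limit p_gt0 A_trunc B_trunc (H_trunc m) (jacobi_coef m)).
Qed.

End TwistedModule.

Theorem theorem3p9 (R : realType) (V : lmodType R[i]) (A : voa V)
    (p : nat) (p_gt0 : (0 < p)%N)
    (wp : R[i]) (wp_prim : p.-primitive_root wp)
    (nu : voa_aut A) (nu_p : forall v, iter p nu v = v)
    (M : lmodType R[i]) (YM : vertex_map V M)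
    (YM_linear : vmap_linear YM)
    (YM_trunc : truncation p YM)
    (YM_jacobi : twisted_jacobi nu p wp YM)
    (u v : V) (s : int) :
  let k := comm_order p YM u v in
  forall w : M,
    is_formal_lim p wp s
      (fmul (binpow p (p * k)%:Z x1root (x2 p) (-1)) (Y1Y2 YM u v w))
      (xmul (x0 *+ k) (Yiter (vY A) YM (aut_pow nu (- s) u) v w)).
Proof. by move=> k w; apply: associativity_limit. Qed.
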